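(* Let $\Gamma$ be a reflexive graph (i.e. every vertex carries a loop). Then $W^+_\Gamma = W^-_\Gamma = W_{\mathrm{Adj}(\Gamma)}$.
   Context: Graphs are finite, may have loops but no parallel edges; $\sim$ denotes adjacency. A compact DVR $\mathfrak O$ has maximal ideal $\mathfrak P$ and residue field of size $q$. For a matrix $A\in\mathrm{Mat}_{n\times m}(\mathfrak O[X_1,\dots,X_\ell])$ of linear forms, $\mathsf Z^{\mathrm{ask}}_{A/\mathfrak O}(T)=\sum_{k\ge0}\alpha_kT^k$ where $\alpha_k$ is the average of $|\ker A(x)|$ over $x\in(\mathfrak O/\mathfrak P^k)^\ell$ ($A(x)$ acting on row vectors in $(\mathfrak O/\mathfrak P^k)^n$ by right multiplication). For a graph $\Gamma$ on $v_1,\dots,v_n$, $\mathsf A^\pm_\Gamma=[X_{ij}]$ is the $n\times n$ matrix with $X_{ij}=0$ iff $v_i\not\sim v_j$, $X_{ji}=\pm X_{ij}$ for $i\ne j$, and the nonzero $X_{ij}$ with $i\le j$ algebraically independent. A hypergraph is $\mathsf H=(V,E,\imath)$ with finite sets $V,E$ and incidence relation $\imath\subset V\times E$; its linearised incidence matrix $\mathsf A_\mathsf H$ is the $|V|\times|E|$ matrix whose $(v,e)$ entry is a variable $X_{(v,e)}$ (distinct variables) if $v\,\imath\, e$ and $0$ otherwise. The adjacency hypergraph of $\Gamma=(V,E)$ is $\mathrm{Adj}(\Gamma)=(V,V,\sim)$. It is known that there are rational functions $W_\mathsf H, W^+_\Gamma, W^-_\Gamma\in\mathbf Q(X,T)$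 with $\mathsf Z^{\mathrm{ask}}_{\mathsf A_\mathsf H/\mathfrak O}(T)=W_\mathsf H(q,T)$ and $\mathsf Z^{\mathrm{ask}}_{\mathsf A^-_\Gamma/\mathfrak O}(T)=W^-_\Gamma(q,T)$ for all compact DVRs $\mathfrak O$, and $\mathsf Z^{\mathrm{ask}}_{\mathsf A^+_\Gamma/\mathfrak O}(T)=W^+_\Gamma(q,T)$ for all compact DVRs $\mathfrak O$ of odd residue field size $q$. *)

(* Defs.v *)
From HB Require Import structures.
From mathcomp Require Import all_boot all_order all_algebra.
From mathcomp Require Import finmap.
From mathcomp Require Import boolp classical_sets functions cardinality fsbigop.
From mathcomp Require Import topology_structure compact.
From mathcomp Require Import mpoly.

Set Implicit Arguments.
Unset Strict Implicit.
Unset Printing Implicit Defensive.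

Import GRing.Theory.

Local Open Scope ring_scope.
Local Open Scope classical_set_scope.
Local Open Scope quotient_scope.

(* The ideals of MathComp's ring_quotient are proper.  The unit ideal is      *)
(* needed here, as O / P^0 is the zero ring; hence the bundled ideals below   *)
(* and quotients that are only pzRings.                                       *)

Record ideal (R : comNzRingType) := Ideal {
  ideal_set :> R -> Prop;
  ideal0 : ideal_set 0;
  idealD : forall x y, ideal_set x -> ideal_set y -> ideal_set (x + y);
  idealM : forall a x, ideal_set x -> ideal_set (a * x) }.

Section Ideals.
Variable R : comNzRingType.
Implicit Types (I J M P : ideal R).

Definition principal I := exists a, ideal_set I = [set b * a | b in [set: R]].

Definition maximal_ideal M :=
  ~ M 1 /\ forall J, ideal_set M `<=` ideal_set J -> ideal_set J = ideal_set M \/ J 1.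

Definition unit_ideal : ideal R.
Proof. by apply: (@Ideal R [set: R]). Defined.

Definition ideal_mul_set I J : set R :=
  [set x | exists s : seq (R * R),
     {in s, forall p, I p.1 /\ J p.2} /\ x = \sum_(p <- s) p.1 * p.2].

Fact ideal_mul_set0 I J : ideal_mul_set I J 0.
Proof. by exists [::]; split=> //; rewrite big_nil. Qed.

Fact ideal_mul_setD I J x y :
  ideal_mul_set I J x -> ideal_mul_set I J y -> ideal_mul_set I J (x + y).
Proof.
move=> [s [sIJ ->]] [t [tIJ ->]]; exists (s ++ t); split; last by rewrite big_cat.
by move=> p; rewrite mem_cat => /orP[/sIJ|/tIJ].
Qed.

Fact ideal_mul_setM I J a x : ideal_mul_set I J x -> ideal_mul_set I J (a * x).
Proof.
move=> [s [sIJ ->]]; exists [seq (a * p.1, p.2) | p <- s]; split.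
  by move=> _ /mapP[p /sIJ[Ip Jp] ->]; split=> //; apply: idealM.
by rewrite big_map mulr_sumr; apply: eq_bigr => p _; rewrite mulrA.
Qed.

Definition ideal_mul I J : ideal R :=
  Ideal (ideal_mul_set0 I J) (@ideal_mul_setD I J) (@ideal_mul_setM I J).

Fixpoint ideal_pow P (k : nat) : ideal R :=
  if k is k'.+1 then ideal_mul P (ideal_pow P k') else unit_ideal.

Definition ideal_pred I : R -> bool := fun x => `[< I x >].

Fact ideal_pred_zmod_closed I : zmod_closed (ideal_pred I).
Proof.
split=> [|x y /asboolP Ix /asboolP Iy]; apply/asboolP; first exact: ideal0.
by apply: idealD => //; rewrite -mulN1r; apply: idealM.
Qed.

HB.instance Definition _ I :=
  GRing.isZmodClosed.Build R (ideal_pred I) (ideal_pred_zmod_closed I).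

Definition quotient I : Type :=
  Quotient.quot (GRing.ZmodClosed.clone R (ideal_pred I) _).

HB.instance Definition _ I := Choice.on (quotient I).
HB.instance Definition _ I := EqQuotient.on (quotient I).
HB.instance Definition _ I := GRing.Zmodule.on (quotient I).

End Ideals.

Definition quotient_proj (R : comNzRingType) (I : ideal R) : R -> quotient I :=
  \pi_(quotient I).

Section QuotientRing.
Variables (R : comNzRingType) (I : ideal R).
Local Notation Q := (quotient I).
Local Notation proj := (@quotient_proj R I).

Fact quotient_projP x y : proj x = proj y <-> I (x - y).
Proof.
rewrite /quotient_proj; split=> [/eqP|Ixy].
  by rewrite -Quotient.idealrBE => /asboolP.
by apply/eqP; rewrite -Quotient.idealrBE; apply/asboolP.
Qed.

Fact quotient_projD : {morph proj : x y / x + y}.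
Proof. by move=> x y; rewrite /quotient_proj !piE. Qed.

Fact quotient_proj_surj u : exists x, u = proj x.
Proof. by exists (repr u); rewrite /quotient_proj reprK. Qed.

Definition quotient_mul (u v : Q) : Q := proj (repr u * repr v).

Fact quotient_projM x y : proj (x * y) = quotient_mul (proj x) (proj y).
Proof.
have rK z : I (z - repr (proj z)).
  by apply/quotient_projP; rewrite /quotient_proj reprK.
apply/quotient_projP; rewrite -(addrNK (x * repr (proj y)) (x * y)) -mulrBr.
rewrite -addrA -mulrBl.
by apply: idealD; [apply: idealM | rewrite mulrC; apply: idealM].
Qed.

Fact quotient_mulA : associative quotient_mul.
Proof.
move=> u v w; have [[x ->] [y ->]] := (quotient_proj_surj u, quotient_proj_surj v).
by have [z ->] := quotient_proj_surj w; rewrite -!quotient_projM mulrA.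
Qed.

Fact quotient_mulC : commutative quotient_mul.
Proof.
move=> u v; have [[x ->] [y ->]] := (quotient_proj_surj u, quotient_proj_surj v).
by rewrite -!quotient_projM mulrC.
Qed.

Fact quotient_mul1 : left_id (proj 1) quotient_mul.
Proof.
by move=> u; have [x ->] := quotient_proj_surj u; rewrite -quotient_projM mul1r.
Qed.

Fact quotient_mulDl : left_distributive quotient_mul +%R.
Proof.
move=> u v w; have [[x ->] [y ->]] := (quotient_proj_surj u, quotient_proj_surj v).
have [z ->] := quotient_proj_surj w.
by rewrite -quotient_projD -!quotient_projM mulrDl quotient_projD.
Qed.

HB.instance Definition _ := GRing.Zmodule_isComPzRing.Build Q
  quotient_mulA quotient_mulC quotient_mul1 quotient_mulDl.

End QuotientRing.

(* R endowed with its P-adic topology. *)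
Definition adic (R : comNzRingType) (P : ideal R) : Type := R.

Section AdicTopology.
Variables (R : comNzRingType) (P : ideal R).

Definition adic_open (U : set (adic P)) :=
  forall x : R, U x -> exists k, forall y : R, ideal_pow P k (y - x) -> U y.

Fact adic_openT : adic_open [set: adic P].
Proof. by move=> x _; exists 0%N. Qed.

Fact ideal_pow_le m n : (m <= n)%N -> ideal_set (ideal_pow P n) `<=` ideal_set (ideal_pow P m).
Proof.
move=> /subnK <-; elim: (n - m)%N => // d IHd x.
rewrite addSn => -[s [sP ->]]; apply: IHd; rewrite big_seq.
elim/big_ind: _ => [|u v|p /sP[_ ?]]; [exact: ideal0|exact: idealD|exact: idealM].
Qed.

Fact adic_openI : setI_closed adic_open.
Proof.
move=> U V oU oV x [/oU[m mU] /oV[n nV]]; exists (maxn m n) => y yx.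
split; [apply: mU | apply: nV]; apply: ideal_pow_le yx.
  exact: leq_maxl.
exact: leq_maxr.
Qed.

Fact adic_open_bigcup (I : Type) (f : I -> set (adic P)) :
  (forall i, adic_open (f i)) -> adic_open (\bigcup_i f i).
Proof. by move=> of_ x [i _ /of_[k kf]]; exists k => y /kf; exists i. Qed.

HB.instance Definition _ := Choice.copy (adic P) R.
HB.instance Definition _ := isOpenTopological.Build (adic P)
  adic_openT adic_openI adic_open_bigcup.

End AdicTopology.

(* A DVR is a PID with a unique maximal ideal, the latter being nonzero. *)
Record compactDVR := CompactDVR {
  dvr_sort :> idomainType;
  dvr_max : ideal dvr_sort;
  dvr_pid : forall I : ideal dvr_sort, principal I;
  dvr_maxP : maximal_ideal dvr_max;
  dvr_local : forall M : ideal dvr_sort,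
    maximal_ideal M -> ideal_set M = ideal_set dvr_max;
  dvr_max_neq0 : exists2 x, dvr_max x & x != 0;
  dvr_compact : compact [set: adic dvr_max] }.

(* Cardinality of a finite set (0 for an infinite one). *)
Definition ncard (T : choiceType) (A : set T) : nat := #|` fset_set A|.

Definition residue_size (O : compactDVR) : nat :=
  ncard [set: quotient (dvr_max O)].

Section Ask.
Variables (O : compactDVR) (n m l : nat) (A : 'M[{mpoly O[l]}]_(n, m)).

Definition residue_ring (k : nat) := quotient (ideal_pow (dvr_max O) k).

(* The value of a polynomial over O at a point of O / P^k.  [mmap] and        *)
(* [meval] do not apply since their target has to be a nontrivial ring.       *)
Definition mpoly_at (k : nat) (x : 'rV[residue_ring k]_l) (p : {mpoly O[l]}) :
    residue_ring k :=
  \sum_(u <- msupp p) quotient_proj (ideal_pow (dvr_max O) k) p@_u *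
    \prod_(i < l) x 0 i ^+ u i.

Definition mx_at (k : nat) (x : 'rV[residue_ring k]_l) :
  'M[residue_ring k]_(n, m) := map_mx (mpoly_at x) A.

Definition left_ker (k : nat) (B : 'M[residue_ring k]_(n, m)) :
  set 'rV[residue_ring k]_n := [set v | v *m B = 0].

Definition ask (k : nat) : rat :=
  (\sum_(x \in [set: 'rV[residue_ring k]_l])
      ((ncard (left_ker (mx_at x)))%:R : rat)) /
  (ncard [set: 'rV[residue_ring k]_l])%:R.

End Ask.

(* Q(X,T), as the fraction field of Q[X][T]. *)
Notation ratfun := {fraction {poly {poly rat}}}.

(* W(q,T) = sum_k Z_k T^k: W = a / b for polynomials a, b such that b(q,T) is *)
(* a nonzero element of Q[T] (so that W has a well-defined specialization at  *)
(* X = q), and b(q,T) * sum_k Z_k T^k = a(q,T) in Q[[T]], coefficientwise.    *)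
Definition specializes_to (W : ratfun) (q : nat) (Z : nat -> rat) : Prop :=
  exists a b : {poly {poly rat}},
    let aq := map_poly (horner_eval q%:R) a in
    let bq := map_poly (horner_eval q%:R) b in
    [/\ W = tofrac a / tofrac b, bq != 0 &
        forall k, \sum_(i < k.+1) bq`_i * Z (k - i)%N = aq`_k].

(* Z^ask_{A/O}(T) = W(q,T) for all compact DVRs O whose residue field size q  *)
(* satisfies [good].                                                          *)
Definition ask_ratfun (good : pred nat) (n m l : nat)
    (A : forall R : comNzRingType, 'M[{mpoly R[l]}]_(n, m)) (W : ratfun) : Prop :=
  forall O : compactDVR, good (residue_size O) ->
    specializes_to W (residue_size O) (ask (A O)).

Record graph := Graph {
  vertex : finType;
  adj : rel vertex;
  adj_sym : ssrbool.symmetric adj }.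

Definition reflexive_graph (G : graph) := reflexive (@adj G).

Record hypergraph := Hypergraph {
  hvertex : finType;
  hedge : finType;
  incident : hvertex -> hedge -> bool }.

Definition Adj (G : graph) : hypergraph := Hypergraph (@adj G).

(* Distinct variables attached to the elements of T satisfying P; the value   *)
(* is 0 at the elements not satisfying P.                                     *)
Definition var_at (R : comNzRingType) (T : finType) (P : pred T) (t : T) :
    {mpoly R[#|{: {x | P x}}|]} :=
  if insub t is Some u then 'X_(enum_rank (u : {x | P x})) else 0.

(* The vertices of G are numbered by [enum_val]: v_i = enum_val i. *)
Definition edge_pos (G : graph) : pred ('I_#|vertex G| * 'I_#|vertex G|) :=
  fun ij => (ij.1 <= ij.2)%N && adj (enum_val ij.1) (enum_val ij.2).

Definition signed_adjmx (s : bool) (G : graph)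
    (R : comNzRingType) :
    'M[{mpoly R[#|{: {ij | edge_pos (G := G) ij}}|]}]_#|vertex G| :=
  \matrix_(i, j) if (i <= j)%N then var_at R (@edge_pos G) (i, j)
                 else (-1) ^+ s *: var_at R (@edge_pos G) (j, i).

Definition adjmx_plus := signed_adjmx false.
Definition adjmx_minus := signed_adjmx true.

Definition incidence_pos (H : hypergraph) : pred ('I_#|hvertex H| * 'I_#|hedge H|) :=
  fun ij => incident (enum_val ij.1) (enum_val ij.2).

Definition incidence_mx (H : hypergraph) (R : comNzRingType) :
    'M[{mpoly R[#|{: {ij | incidence_pos (H := H) ij}}|]}]_(#|hvertex H|, #|hedge H|) :=
  \matrix_(i, j) var_at R (@incidence_pos H) (i, j).

Definition is_W_plus (G : graph) : ratfun -> Prop := ask_ratfun odd (@adjmx_plus G).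
Definition is_W_minus (G : graph) : ratfun -> Prop := ask_ratfun predT (@adjmx_minus G).
Definition is_W (H : hypergraph) : ratfun -> Prop := ask_ratfun predT (@incidence_mx H).

(* Main.v *)
(* Fixing the row vector v and averaging over x first, the k-th coefficient of the ask zeta
   function of a matrix A of linear forms is the sum over v of 1/|{v A(x) : x}|, as
   x |-> v A(x) is additive.  For a reflexive graph, the set {v A(x) : x} is the same for all
   three matrices: it is spanned by the v_i e_j with i ~ j.  Indeed, in O/P^k either v_j = c v_i
   or v_i = c v_j; in the first case v_j e_i = c (v_i e_i) is supplied by the loop at i, so that
   v_i e_j can be extracted from v_i e_j +- v_j e_i; in the second case v_i e_j = c (v_j e_j)
   is supplied by the loop at j.  Hence the three rational functions have the same
   specialisation at X = q whenever q is the odd residue field size of some compact DVR with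
   finite residue rings and total divisibility.  The rings F_p[[t]] with p an odd prime are of
   this kind and provide infinitely many values of q. *)

Require Import Defs.
From HB Require Import structures.
From mathcomp Require Import all_boot all_order all_algebra.
From mathcomp Require Import finmap.
From mathcomp Require Import boolp classical_sets functions cardinality fsbigop.
From mathcomp Require Import filter topology_structure compact mpoly.
From mathcomp Require Import ring.

Set Implicit Arguments.
Unset Strict Implicit.
Unset Printing Implicit Defensive.

Import GRing.Theory Num.Theory.

Local Open Scope ring_scope.
Local Open Scope classical_set_scope.

(** * Matrices with the support of a graph *)

Section QuotientProj.
Variables (R : comNzRingType) (I : ideal R).

Lemma quotient_proj0 : quotient_proj I 0 = 0.
Proof. by apply: (addrI (quotient_proj I 0)); rewrite -quotient_projD !addr0. Qed.

Lemma quotient_projN x : quotient_proj I (- x) = - quotient_proj I x.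
Proof. by apply/eqP; rewrite -subr_eq0 opprK -quotient_projD addNr quotient_proj0. Qed.

Lemma quotient_proj_sign (s : bool) : quotient_proj I ((-1) ^+ s) = (-1) ^+ s.
Proof. by case: s; rewrite ?expr1 ?quotient_projN. Qed.

Lemma quotient_dvd_total :
    (forall x y : R, exists c, x = c * y \/ y = c * x) ->
  forall a b : quotient I, exists c, a = c * b \/ b = c * a.
Proof.
move=> R_total a b.
have [[x ->] [y ->]] := (quotient_proj_surj a, quotient_proj_surj b).
by have [c [->|->]] := R_total x y; exists (quotient_proj I c); [left|right];
  rewrite quotient_projM.
Qed.

End QuotientProj.

(** Evaluation counterpart of [var_at], with the same default 0 off [P]. *)
Definition coord_at (Q : nmodType) (T : finType) (P : pred T)
    (x : 'rV[Q]_#|{: {t | P t}}|) (t : T) : Q :=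
  if insub t is Some u then x 0 (enum_rank (u : {t | P t})) else 0.

Lemma coord_atD (Q : nmodType) (T : finType) (P : pred T)
    (x y : 'rV[Q]_#|{: {t | P t}}|) t :
  coord_at (x + y) t = coord_at x t + coord_at y t.
Proof. by rewrite /coord_at; case: insub => [u|]; rewrite ?mxE ?addr0. Qed.

Lemma coord_at_row (Q : nmodType) (T : finType) (P : pred T) (f : T -> Q) t :
    (~~ P t -> f t = 0) ->
  coord_at (\row_r f (val (enum_val r : {t | P t}))) t = f t.
Proof.
rewrite /coord_at => ft; case: insubP => [u _ <-|/ft //].
by rewrite mxE enum_rankK.
Qed.

Lemma mpoly_at_signed_var (O : compactDVR) (k : nat) (T : finType) (P : pred T)
    (s : bool) (t : T) (x : 'rV[residue_ring O k]_#|{: {t | P t}}|) :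
  mpoly_at x ((-1) ^+ s *: var_at O P t) = (-1) ^+ s * coord_at x t.
Proof.
rewrite /mpoly_at /var_at /coord_at; case: insubP => [u _ _|_]; last first.
  by rewrite scaler0 msupp0 big_nil mulr0.
(* The sign is nonzero, so the support is a single monomial. *)
rewrite msuppMCX ?signr_eq0 // big_seq1 mcoeffZ mcoeffX eqxx mulr1.
congr (_ * _); first exact: quotient_proj_sign.
rewrite (bigD1 (enum_rank u)) //= big1 ?mulr1 => [|j ju].
  by rewrite mnm1E eqxx.
by rewrite mnm1E eq_sym (negPf ju).
Qed.

Lemma mpoly_at_var (O : compactDVR) (k : nat) (T : finType) (P : pred T)
    (t : T) (x : 'rV[residue_ring O k]_#|{: {t | P t}}|) :
  mpoly_at x (var_at O P t) = coord_at x t.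
Proof.
by rewrite -[var_at _ _ _]scale1r -(expr0 (-1)) (mpoly_at_signed_var false) expr0 mul1r.
Qed.

Definition adj_supported (G : graph) (Q : nmodType) (M : 'M[Q]_#|vertex G|) :=
  forall i j, ~~ adj (enum_val i) (enum_val j) -> M i j = 0.

(** Only i < j is constrained: diagonal entries stay free for either sign, which is what lets loops
    act independently of the sign. *)
Definition adj_signed (s : bool) (G : graph) (Q : pzRingType) (M : 'M[Q]_#|vertex G|) :=
  adj_supported M /\ forall i j : 'I_#|vertex G|, (i < j)%N -> M j i = (-1) ^+ s * M i j.

Section MatrixSpaces.
Variables (O : compactDVR) (k : nat) (G : graph).
Implicit Types i j : 'I_#|vertex G|.

Lemma mx_at_signed_adjmxE (s : bool) x i j :
  mx_at (k := k) (signed_adjmx s G O) x i j =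
    if (i <= j)%N then coord_at x (i, j) else (-1) ^+ s * coord_at x (j, i).
Proof. by rewrite !mxE; case: leqP; rewrite ?mpoly_at_signed_var ?mpoly_at_var. Qed.

Lemma mx_at_incidence_mxE x i j :
  mx_at (k := k) (incidence_mx (Adj G) O) x i j = coord_at x (i, j).
Proof. by rewrite !mxE mpoly_at_var. Qed.

Lemma mx_at_signed_adjmxD (s : bool) :
  {morph mx_at (k := k) (signed_adjmx s G O) : x y / x + y}.
Proof.
move=> x y; apply/matrixP => i j; rewrite [RHS]mxE !mx_at_signed_adjmxE !coord_atD.
by case: leqP; rewrite ?mulrDr.
Qed.

Lemma mx_at_incidence_mxD :
  {morph mx_at (k := k) (incidence_mx (Adj G) O) : x y / x + y}.
Proof.
by move=> x y; apply/matrixP => i j; rewrite [RHS]mxE !mx_at_incidence_mxE coord_atD.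
Qed.

Lemma range_signed_adjmx (s : bool) :
  range (mx_at (k := k) (signed_adjmx s G O)) = [set M | adj_signed s M].
Proof.
apply/seteqP; split=> [_ [x _ <-]|M [Madj Ms]] /=.
  split=> [i j /negPf nij|i j ij]; rewrite !mx_at_signed_adjmxE; last first.
    by rewrite leqNgt ij /= ltnW.
  rewrite /coord_at !insubF /edge_pos /= ?nij ?andbF ?mulr0 ?if_same //.
  by rewrite adj_sym nij andbF.
exists (\row_t let ij := val (enum_val t) in M ij.1 ij.2) => //.
apply/matrixP => i j; rewrite mx_at_signed_adjmxE.
have ME (a b : 'I_#|vertex G|) : (a <= b)%N ->
    coord_at (\row_t let ij := val (enum_val t : {ij | edge_pos (G := G) ij}) in M ij.1 ij.2)
      (a, b) = M a b.
  move=> ab; rewrite (coord_at_row (f := fun ij => M ij.1 ij.2)) //.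
  by rewrite /edge_pos /= ab /= => /Madj.
by case: leqP => ij; rewrite ME ?(ltnW ij) // (Ms j i ij).
Qed.

Lemma range_incidence_mx :
  range (mx_at (k := k) (incidence_mx (Adj G) O)) = [set M | adj_supported M].
Proof.
apply/seteqP; split=> [_ [x _ <-] i j /negPf nij|M Madj].
  by rewrite mx_at_incidence_mxE /coord_at insubF.
exists (\row_t let ij := val (enum_val t) in M ij.1 ij.2) => //.
apply/matrixP => i j; rewrite mx_at_incidence_mxE.
by rewrite (coord_at_row (f := fun ij => M ij.1 ij.2)) // => /Madj.
Qed.

End MatrixSpaces.

(** For the nontrivial inclusion, the set [S] of vectors reached by signed matrices is closed under
    addition, so it suffices to reach v (a E_ij) for each adjacent pair i, j. *)
Lemma vecmul_signed_supported (s : bool) (G : graph) (Q : comPzRingType)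
    (v : 'rV[Q]_#|vertex G|) :
    reflexive_graph G -> (forall a b : Q, exists c, a = c * b \/ b = c * a) ->
  [set v *m M | M in [set M | adj_signed s M]] =
  [set v *m M | M in [set M | adj_supported M]].
Proof.
move=> G_refl Q_total; apply/seteqP; split=> [_ [M [Msupp _] <-]|_ [M /= Msupp <-]] /=.
  by exists M.
pose S w := exists2 N, adj_signed s N & v *m N = w.
rewrite -/(S (v *m M)).
have S0 : S 0.
  by exists 0; rewrite ?mulmx0 //; split=> [i j|i j _]; rewrite !mxE ?mulr0.
have SD w1 w2 : S w1 -> S w2 -> S (w1 + w2).
  move=> [M1 [M1s M1a] <-] [M2 [M2s M2a] <-]; exists (M1 + M2); rewrite ?mulmxDr //.
  split=> [i j nij|i j ij]; rewrite !mxE; first by rewrite M1s ?M2s ?addr0.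
  by rewrite (M1a i j ij) (M2a i j ij) mulrDr.
have Sdiag a i : S (v *m (a *: delta_mx i i)).
  exists (a *: delta_mx i i) => //; split=> [j k njk|j k jk]; rewrite !mxE.
    have [/andP[/eqP ji /eqP ki]|_] := boolP ((j == i) && (k == i)); last exact: mulr0.
    by rewrite ji ki G_refl in njk.
  rewrite [(j == i) && _]andbC.
  have [/andP[/eqP ki /eqP ji]|_] := boolP ((k == i) && (j == i)); last by rewrite !mulr0.
  by move: jk; rewrite ki ji ltnn.
have Ssym a i j : adj (enum_val i) (enum_val j) ->
    S (v *m (a *: delta_mx i j + (-1) ^+ s * a *: delta_mx j i)).
  move=> aij; exists (a *: delta_mx i j + (-1) ^+ s * a *: delta_mx j i) => //.
  split=> [x y nxy|x y xy]; rewrite !mxE.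
    case: (boolP ((x == i) && (y == j))) nxy => [/andP[/eqP-> /eqP->]|_ nxy].
      by rewrite aij.
    case: (boolP ((x == j) && (y == i))) nxy => [/andP[/eqP-> /eqP->]|_ _].
      by rewrite adj_sym aij.
    by rewrite !mulr0 addr0.
  rewrite [(y == i) && _]andbC [(y == j) && _]andbC.
  by rewrite mulrDr !mulrA -signr_addb addbb mul1r addrC.
have Sedge a i j : adj (enum_val i) (enum_val j) -> S (v *m (a *: delta_mx i j)).
  move=> aij; have vdelta b x y : v *m (b *: delta_mx x y) = (b * v 0 x) *: delta_mx 0 y.
    apply/rowP => z; rewrite -scalemxAr !mxE (bigD1 x) //= big1 => [|t tx].
      by rewrite !mxE !eqxx /= addr0 mulrA.
    by rewrite mxE (negPf tx) mulr0.
  have [c [vi|vj]] := Q_total (v 0 i) (v 0 j).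
    (* Here a v_i e_j = a c v_j e_j, which the loop at j supplies. *)
    suff -> : v *m (a *: delta_mx i j) = v *m (a * c *: delta_mx j j) by exact: Sdiag.
    by rewrite !vdelta vi mulrA.
  (* The signed pair yields a v_i e_j + (-1)^s a v_j e_i; as v_j = c v_i, the loop at i cancels the
     second term. *)
  suff -> : v *m (a *: delta_mx i j) =
      v *m (a *: delta_mx i j + (-1) ^+ s * a *: delta_mx j i) +
      v *m (- ((-1) ^+ s * a * c) *: delta_mx i i).
    by apply: SD; [exact: Ssym | exact: Sdiag].
  by rewrite mulmxDr !vdelta vj mulNr scaleNr mulrA addrK.
rewrite (matrix_sum_delta M) mulmx_sumr; apply: (big_ind S) => // i _.
rewrite mulmx_sumr; apply: (big_ind S) => // j _.
have [aij|/Msupp ->] := boolP (adj (enum_val i) (enum_val j)); first exact: Sedge.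
by rewrite scale0r mulmx0.
Qed.

(** * Average sizes of kernels *)

Lemma finite_rV (T : choiceType) n :
  finite_set [set: T] -> finite_set [set: 'rV[T]_n].
Proof.
move=> finT; pose E := fset_set [set: T].
have xE x : x \in E by rewrite in_fset_set // inE.
have -> : [set: 'rV[T]_n] = [set \row_j val (g j) | g in [set: {ffun 'I_n -> E}]].
  apply/seteqP; split=> // v _; exists [ffun j => [` xE (v 0 j)]%fset] => //.
  by apply/rowP => j; rewrite mxE ffunE.
exact/finite_image/finite_finset.
Qed.

Lemma ncard_sum (T : choiceType) (A : set T) : finite_set [set: T] ->
  ncard A = (\sum_(x <- fset_set [set: T] | `[< A x >]) 1)%N.
Proof.
move=> finT; have finA := sub_finite_set (@subsetT _ A) finT.
rewrite /ncard; have -> : fset_set A = [fset x in fset_set [set: T] | `[< A x >]]%fset.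
  apply/fsetP => x; rewrite !inE !in_fset_set // in_setT /=.
  by apply/idP/asboolP; rewrite inE.
by rewrite card_fset_sum1 big_fset.
Qed.

(** Every nonempty fibre of [f] is a translate of its kernel. *)
Lemma ncard_ker_im (U V : zmodType) (f : U -> V) :
    finite_set [set: U] -> {morph f : x y / x + y} ->
  ncard [set: U] = (ncard (range f) * ncard [set x | f x = 0%R])%N.
Proof.
move=> finU fD; have finA (A : set U) := sub_finite_set (@subsetT _ A) finU.
rewrite {1}/ncard card_fset_sum1 (partition_big_imfset _ f) /=.
rewrite /ncard fset_set_image // [X in (X * _)%N]card_fset_sum1 big_distrl /=.
rewrite [LHS]big_seq [RHS]big_seq; apply: eq_bigr => _ /imfsetP[x0 /= _ ->].
rewrite mul1n -/(ncard _).
have -> : [set x | f x = 0] = [set x - x0 | x in [set x | f x = f x0]].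
  apply/seteqP; split=> [x /= fx|_ [x /= fx <-]].
    by exists (x + x0); rewrite ?addrK //= fD fx add0r.
  by apply: (addIr (f x0)); rewrite -fD subrK add0r.
transitivity (ncard [set x | f x = f x0]).
  by rewrite ncard_sum //; apply: eq_bigl => x; apply/eqP/asboolP.
apply/fcard_eq; [exact: finA|exact: finA|].
by rewrite card_eq_sym; apply: inj_card_eq => x y _ _ /addIr.
Qed.

(** The pairs (x, v) with v A(x) = 0 are counted by v first: for fixed v the x form the kernel of an
    additive map, whose proportion in the domain is the inverse of the size of the image. *)
Lemma ask_image (O : compactDVR) n m l (A : 'M[{mpoly O[l]}]_(n, m)) k :
    finite_set [set: residue_ring O k] -> {morph mx_at (k := k) A : x y / x + y} ->
  ask A k = \sum_(v \in [set: 'rV[residue_ring O k]_n])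
    ((ncard [set v *m M | M in range (mx_at (k := k) A)])%:R : rat)^-1.
Proof.
move=> finQ AD; have finr r := @finite_rV _ r finQ.
rewrite /ask !fsbig_finite ?mulr_suml; [|exact: finr..].
under [LHS]eq_bigr => x _ do rewrite (ncard_sum _ (finr n)) natr_sum big_mkcond mulr_suml.
rewrite exchange_big /=; apply: eq_bigr => v _.
rewrite -mulr_suml -big_mkcond -natr_sum /=.
have -> := @ncard_ker_im _ _ (fun x => v *m mx_at A x) (finr l); last first.
  by move=> x y; rewrite AD mulmxDr.
rewrite -(ncard_sum _ (finr l)) -[X in (ncard X * _)%N](image_comp (@mx_at _ _ _ _ A k)).
set K := ncard [set x | _].
(* The kernel contains 0, so its size can be cancelled. *)
have K0 : (K%:R : rat) != 0.
  rewrite pnatr_eq0 -lt0n cardfs_gt0; apply/fset0Pn; exists 0.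
  rewrite in_fset_set ?inE; last exact: (sub_finite_set (@subsetT _ _) (finr l)).
  by apply: (addrI (v *m mx_at A 0)); rewrite -mulmxDr -AD !addr0.
by rewrite natrM invfM mulrCA divff // mulr1.
Qed.

Lemma ask_signed_adjmx (O : compactDVR) (k : nat) (s : bool) (G : graph) :
    finite_set [set: residue_ring O k] ->
    (forall x y : O, exists c, x = c * y \/ y = c * x) -> reflexive_graph G ->
  ask (signed_adjmx s G O) k = ask (incidence_mx (Adj G) O) k.
Proof.
move=> finQ O_total G_refl.
rewrite (ask_image finQ (mx_at_signed_adjmxD s)) (ask_image finQ (@mx_at_incidence_mxD _ _ _)).
apply: eq_fsbigr => v _; congr ((ncard _)%:R^-1).
rewrite range_signed_adjmx range_incidence_mx.
exact/vecmul_signed_supported/quotient_dvd_total.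
Qed.

(** * Formal power series over a field *)

(** A separate name for nat -> F keeps pointwise addition while the product becomes convolution. *)
Definition pseries (F : fieldType) : Type := nat -> F.

HB.instance Definition _ (F : fieldType) := GRing.Zmodule.copy (pseries F) (nat -> F).

Section PowerSeries.
Variable F : fieldType.
Implicit Types f g h : pseries F.

Definition pseries_mul f g : pseries F :=
  fun n => \sum_(i < n.+1) f i * g (n - i)%N.

Definition pseries_const (c : F) : pseries F := fun n => c *+ (n == 0)%N.

Definition pseries_trunc (N : nat) f : {poly F} := \poly_(i < N.+1) f i.

Lemma coef_pseries_trunc N f i : (i <= N)%N -> (pseries_trunc N f)`_i = f i.
Proof. by move=> iN; rewrite coef_poly ltnS iN. Qed.

(** Coefficients up to N of a product depend only on those of the factors up to N; this transports
    associativity and commutativity from [{poly F}]. *)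
Lemma pseries_mul_poly f g (p1 p2 : {poly F}) N :
    (forall i, (i <= N)%N -> p1`_i = f i) -> (forall i, (i <= N)%N -> p2`_i = g i) ->
  forall i, (i <= N)%N -> (p1 * p2)`_i = pseries_mul f g i.
Proof.
move=> p1f p2g i iN; rewrite coefM; apply: eq_bigr => -[j /=]; rewrite ltnS => ji _.
by rewrite p1f ?p2g ?(leq_trans ji) // (leq_trans (leq_subr _ _)).
Qed.

Fact pseries_mulA : associative pseries_mul.
Proof.
move=> f g h; apply/funext => n.
have T u := @coef_pseries_trunc n u.
rewrite -(pseries_mul_poly (T f) (pseries_mul_poly (T g) (T h)) (leqnn n)).
by rewrite -(pseries_mul_poly (pseries_mul_poly (T f) (T g)) (T h) (leqnn n)) mulrA.
Qed.

Fact pseries_mulC : commutative pseries_mul.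
Proof.
move=> f g; apply/funext => n.
have T u := @coef_pseries_trunc n u.
rewrite -(pseries_mul_poly (T f) (T g) (leqnn n)).
by rewrite -(pseries_mul_poly (T g) (T f) (leqnn n)) mulrC.
Qed.

Fact pseries_mul1 : left_id (pseries_const 1) pseries_mul.
Proof.
move=> f; apply/funext => n; rewrite /pseries_mul big_ord_recl subn0 mul1r.
by rewrite big1 ?addr0 // => i _; rewrite mul0r.
Qed.

Fact pseries_mulDl : left_distributive pseries_mul +%R.
Proof.
move=> f g h; apply/funext => n; rewrite [RHS]/GRing.add /= /pseries_mul -big_split /=.
by apply: eq_bigr => i _; rewrite -mulrDl.
Qed.

Fact pseries_const1_neq0 : pseries_const 1 != 0.
Proof.
apply/eqP => /(congr1 (fun f : pseries F => f 0%N)) /eqP.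
by rewrite /pseries_const eqxx (oner_eq0 F).
Qed.

HB.instance Definition _ := GRing.Zmodule_isComNzRing.Build (pseries F)
  pseries_mulA pseries_mulC pseries_mul1 pseries_mulDl pseries_const1_neq0.

Lemma coef_pseriesD f g n : (f + g) n = f n + g n. Proof. by []. Qed.
Lemma coef_pseriesB f g n : (f - g) n = f n - g n. Proof. by []. Qed.
Lemma coef_pseries1 n : (1 : pseries F) n = (n == 0)%N%:R. Proof. by []. Qed.
Lemma coef_pseriesM f g n : (f * g) n = \sum_(i < n.+1) f i * g (n - i)%N.
Proof. by []. Qed.

(* The coefficients g_0, ..., g_(n-1) of the inverse of f, from the recursion
   sum_(i <= m) g_i f_(m-i) = [m = 0]. *)
Fixpoint pseries_inv_seq f (n : nat) : seq F :=
  if n is n'.+1 then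
    let s := pseries_inv_seq f n' in
    rcons s ((f 0%N)^-1 * ((n' == 0)%N%:R - \sum_(i < n') s`_i * f (n' - i)%N))
  else [::].

Definition pseries_inv_coef f : pseries F := fun n => (pseries_inv_seq f n.+1)`_n.

Lemma size_pseries_inv_seq f n : size (pseries_inv_seq f n) = n.
Proof. by elim: n => //= n IHn; rewrite size_rcons IHn. Qed.

(** Each prefix extends the previous one, so an entry does not depend on the prefix it is read
    from. *)
Lemma nth_pseries_inv_seq f n i :
  (i < n)%N -> (pseries_inv_seq f n)`_i = pseries_inv_coef f i.
Proof.
elim: n => // n IHn; rewrite ltnS leq_eqVlt => /orP[/eqP-> //|lt_in].
by rewrite /= nth_rcons size_pseries_inv_seq lt_in IHn.
Qed.

Lemma pseries_inv_coefP f : f 0%N != 0 -> pseries_inv_coef f * f = 1.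
Proof.
move=> f0; apply/funext => n; rewrite coef_pseriesM big_ord_recr /= subnn.
(* The last summand holds the newest coefficient, whose factor (f 0)^-1 cancels f 0; the remaining
   sum is then subtracted off. *)
rewrite {2}/pseries_inv_coef /= nth_rcons size_pseries_inv_seq ltnn eqxx.
rewrite mulrAC mulVf // mul1r.
rewrite [X in _ + (_ - X)](eq_bigr (fun i : 'I_n => pseries_inv_coef f i * f (n - i)%N)).
  by rewrite addrC subrK coef_pseries1.
by move=> i _; rewrite nth_pseries_inv_seq.
Qed.

Definition pseries_unit : pred (pseries F) := fun f => f 0%N != 0.

Definition pseries_inv f : pseries F :=
  if pseries_unit f then pseries_inv_coef f else f.

Fact pseries_mulVf : {in pseries_unit, left_inverse 1 pseries_inv *%R}.
Proof. by move=> f uf; rewrite /pseries_inv ifT // pseries_inv_coefP. Qed.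

Fact pseries_unitP f g : g * f = 1 -> pseries_unit f.
Proof.
move=> /(congr1 (fun h : pseries F => h 0%N)).
rewrite coef_pseriesM big_ord1 subn0 coef_pseries1 /= => gf1; apply/eqP => f0.
by move: gf1; rewrite f0 mulr0 => /eqP; rewrite eq_sym oner_eq0.
Qed.

Fact pseries_inv_out : {in [predC pseries_unit], pseries_inv =1 id}.
Proof. by move=> f nuf; rewrite /pseries_inv ifN. Qed.

HB.instance Definition _ := GRing.ComNzRing_hasMulInverse.Build (pseries F)
  pseries_mulVf pseries_unitP pseries_inv_out.

(** * Valuation, divisibility and ideals of power series *)

Definition pseries_X : pseries F := fun n => (n == 1)%N%:R.

Lemma coef_pseriesXM f n : (pseries_X * f) n = if n is n'.+1 then f n' else 0.
Proof.
rewrite coef_pseriesM; case: n => [|n]; first by rewrite big_ord1 mul0r.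
rewrite 2!big_ord_recl mul0r add0r mul1r subSS subn0.
by rewrite big1 ?addr0 // => i _; rewrite mul0r.
Qed.

Lemma coef_pseriesXnM a f n :
  (pseries_X ^+ a * f) n = if (n < a)%N then 0 else f (n - a)%N.
Proof.
elim: a n => [|a IHa] n; first by rewrite mul1r subn0.
by rewrite exprS -mulrA coef_pseriesXM; case: n => // n; rewrite IHa.
Qed.

Lemma pseries_shift f a :
  (forall i, (i < a)%N -> f i = 0) -> f = pseries_X ^+ a * ((fun n => f (n + a)%N) : pseries F).
Proof.
move=> f0; apply/funext => n; rewrite coef_pseriesXnM.
by case: ltnP => [/f0 //|an]; rewrite subnK.
Qed.

(** The exponent is the least index of a nonzero coefficient; the shifted series has nonzero
    constant term. Integrality, divisibility and the ideals are all read off this normal form. *)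
Lemma pseries_val f : f != 0 ->
  exists a, exists2 u : pseries F, u \is a GRing.unit & f = pseries_X ^+ a * u.
Proof.
move=> f0; have exf : exists n, f n != 0.
  apply/not_existsP => fn; case/eqP: f0; apply/funext => n.
  by apply/eqP; apply: contrapT => /negP; apply: fn.
case: (ex_minnP exf) => a fa amin; exists a, (fun n => f (n + a)%N).
  by rewrite unfold_in /= /pseries_unit /= add0n.
apply: pseries_shift => i ia; apply/eqP; apply: contraTT ia => /amin.
by rewrite leqNgt.
Qed.

Lemma pseries_Xn_neq0 a : pseries_X ^+ a != 0.
Proof.
apply/eqP => /(congr1 (fun f : pseries F => f a)) /eqP.
by rewrite -[_ ^+ a]mulr1 coef_pseriesXnM ltnn subnn coef_pseries1 /= oner_eq0.
Qed.

Fact pseries_integral : GRing.integral_domain_axiom (pseries F).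
Proof.
move=> f g fg0; apply/norP => -[/pseries_val[a [u uu fE]] /pseries_val[b [v uv gE]]].
move: fg0; rewrite fE gE mulrACA -exprD => /eqP.
by rewrite mulIr_eq0 ?(negPf (pseries_Xn_neq0 _)) //; apply/mulIr; rewrite unitrM uu.
Qed.

HB.instance Definition _ := GRing.ComUnitRing_isIntegral.Build (pseries F)
  pseries_integral.

(** The series of smaller valuation divides the other. *)
Lemma pseries_dvd_total f g : exists c, f = c * g \/ g = c * f.
Proof.
have [->|/pseries_val[a [u uu ->]]] := eqVneq f 0; first by exists 0; left; rewrite mul0r.
have [->|/pseries_val[b [v uv ->]]] := eqVneq g 0; first by exists 0; right; rewrite mul0r.
wlog ba : a b u v uu uv / (b <= a)%N.
  by case: (leqP b a) => [|/ltnW] ba; [exact | move=> /(_ b a v u uv uu ba)[c [?|?]];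
    exists c; [right|left]].
exists (pseries_X ^+ (a - b) * u * v^-1); left.
by rewrite [_ ^+ b * v]mulrC mulrA divrK // mulrAC -exprD subnK.
Qed.

Definition pseries_max : ideal (pseries F).
Proof.
apply: (@Ideal (pseries F) [set f | f 0%N = 0]) => [//|f g /= f0 g0|a f /= f0].
  by rewrite coef_pseriesD f0 g0 addr0.
by rewrite coef_pseriesM big_ord1 subn0 f0 mulr0.
Defined.

(** Identifies P^k with the series of valuation at least k, the form needed for compactness and for
    finite quotients. *)
Lemma pseries_max_pow k f :
  ideal_pow pseries_max k f <-> forall i, (i < k)%N -> f i = 0.
Proof.
elim: k f => [//|k IHk] f; split.
  move=> [s [sP ->]]; rewrite big_seq.
  elim/big_ind: _ => [//|g h g0 h0 i ik|[g h] /sP[/= g0 /IHk h0] i].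
    by rewrite coef_pseriesD g0 ?h0 ?addr0.
  (* The term of index 0 dies by g 0 = 0; every other one involves a coefficient of h of index below
     k. *)
  rewrite ltnS => ik; rewrite coef_pseriesM big1 // => -[[|j] /= ji] _.
    by rewrite g0 mul0r.
  by rewrite h0 ?mulr0 // (leq_trans _ ik) // ltn_subrL (leq_ltn_trans _ (ji : (j < i)%N)).
(* A series without constant term is X times its shift, so a one-term sum suffices. *)
move=> f0; exists [:: (pseries_X, (fun n => f n.+1) : pseries F)]; split.
  by move=> _ /[!inE] /eqP ->; split => //=; apply/IHk => i ik; apply: f0.
rewrite big_seq1 /=; apply/funext => n; rewrite coef_pseriesXM.
by case: n => //; rewrite f0.
Qed.

(** With each nonzero f, the ideal contains X to the valuation of f. The least such exponent gives a
    generator; if no power of X occurs, the ideal is zero. *)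
Lemma pseries_pid (I : ideal (pseries F)) : principal I.
Proof.
have Xn_mem f : I f -> f != 0 -> exists2 a, I (pseries_X ^+ a) & exists c, f = c * pseries_X ^+ a.
  move=> If /pseries_val[a [u uu fE]]; exists a; last by exists u; rewrite mulrC.
  by rewrite -(mulVKr uu (_ ^+ a)) mulrC -mulrA -fE; apply: idealM.
have [[b Ib]|nI] := pselect (exists b, I (pseries_X ^+ b)); last first.
  exists 0; apply/seteqP; split=> [f If|_ [b _ <-]] /=; last by rewrite mulr0; apply: ideal0.
  exists 0; rewrite // mulr0; apply/esym/eqP; apply: contrapT => /negP f0.
  by case: (Xn_mem f If f0) => a Ia _; apply: nI; exists a.
have exI : exists b, `[< I (pseries_X ^+ b) >] by exists b; apply/asboolP.
case: (ex_minnP exI) => a /asboolP Ia amin; exists (pseries_X ^+ a).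
apply/seteqP; split=> [f If|_ [c _ <-]] /=; last exact: idealM.
have [->|f0] := eqVneq f 0; first by exists 0; rewrite ?mul0r.
have [d Id [c ->]] := Xn_mem f If f0.
exists (c * pseries_X ^+ (d - a)) => //.
by rewrite -mulrA -exprD subnK // amin //; apply/asboolP.
Qed.

Lemma pseries_maxN f : ~ pseries_max f -> f \is a GRing.unit.
Proof. by move=> f0; rewrite unfold_in; apply/eqP. Qed.

Lemma ideal_unit (R : comUnitRingType) (I : ideal R) x : x \is a GRing.unit -> I x -> I 1.
Proof. by move=> ux Ix; rewrite -(mulVr ux); apply: idealM. Qed.

Lemma pseries_maxP : maximal_ideal pseries_max.
Proof.
split=> [/eqP|J PJ]; first by rewrite coef_pseries1 oner_eq0.
have [JP|] := pselect (ideal_set J `<=` ideal_set pseries_max).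
  by left; apply/seteqP; split.
move=> /existsNP[f /not_implyP[Jf /pseries_maxN uf]]; right.
exact: ideal_unit uf Jf.
Qed.

(** A proper ideal has no units, hence lies in [pseries_max]; maximality gives equality. *)
Lemma pseries_local (M : ideal (pseries F)) :
  maximal_ideal M -> ideal_set M = ideal_set pseries_max.
Proof.
move=> [M1 Mmax]; have MP : ideal_set M `<=` ideal_set pseries_max.
  by move=> f Mf; apply: contrapT => /pseries_maxN /ideal_unit /(_ Mf).
by case: (Mmax _ MP) => [->//|/pseries_maxP.1].
Qed.

Lemma pseries_max_neq0 : exists2 x, pseries_max x & x != 0.
Proof. by exists pseries_X => //; apply: (pseries_Xn_neq0 1). Qed.

End PowerSeries.

(** * Compactness and finite quotients over a finite field *)

Section FiniteField.
Variable F : finFieldType.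

(** Otherwise the ultrafilter would contain the complements of all fibres, whose finite intersection
    is empty. *)
Lemma ultra_finite (T : Type) (I : finType) (G : set_system T) (h : T -> I) :
  UltraFilter G -> exists c, G [set x | h x = c].
Proof.
move=> uG; apply: contrapT => /forallNP Gn.
have Gc c : G (~` [set x | h x = c]).
  by have [/Gn|] := in_ultra_setVsetC [set x | h x = c] uG.
have /filter_ex[x xc] : G (\bigcap_(c in [set` [fset c in I]%fset]) ~` [set x | h x = c]).
  exact: filter_bigI.
by apply: (xc (h x)) => //=; rewrite inE.
Qed.

(** Each coefficient is constant on some member of the ultrafilter; these constants form the limit,
    since an adic neighbourhood contains all series agreeing with it up to some finite order. *)
Lemma pseries_compact : compact [set: adic (pseries_max F)].
Proof.
rewrite compact_ultra => G uG _.
have /choice[g gP] : forall n, exists c, G [set f : adic (pseries_max F) | (f : pseries F) n = c].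
  by move=> n; apply: ultra_finite.
exists (g : pseries F); split=> // U.
rewrite nbhsE => -[V [oV Vg] VU].
have [k Vk] := oV _ Vg.
have : G [set f : adic (pseries_max F) | forall i, (i < k)%N -> (f : pseries F) i = g i].
  elim: k {Vk} => [|k IHk]; first by apply: filterS filterT.
  apply: filterS (filterI IHk (gP k)) => f [/= fg fk] i.
  by rewrite ltnS leq_eqVlt => /orP[/eqP ->|/fg].
apply: filterS => f fg; apply/VU/Vk/pseries_max_pow => i ik.
by rewrite coef_pseriesB fg // subrr.
Qed.

Definition pseries_dvr : compactDVR :=
  CompactDVR (@pseries_pid F) (@pseries_maxP F) (@pseries_local F)
    (@pseries_max_neq0 F) pseries_compact.

End FiniteField.

Lemma pseries_residue_finite (F : finFieldType) k :
  finite_set [set: residue_ring (pseries_dvr F) k].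
Proof.
(* Each class is represented by its truncation: k free coefficients, then zeros. *)
pose lft (c : {ffun 'I_k -> F}) : pseries F :=
  fun n => if insub n is Some i then c i else 0.
have -> : [set: residue_ring (pseries_dvr F) k] =
    [set quotient_proj (ideal_pow (dvr_max (pseries_dvr F)) k) (lft c) | c in setT].
  apply/seteqP; split=> // u _; have [f ->] := quotient_proj_surj u.
  exists [ffun i : 'I_k => f i] => //; apply/quotient_projP/pseries_max_pow => i ik.
  by rewrite coef_pseriesB /lft insubT ffunE subrr.
exact/finite_image/finite_finset.
Qed.

Lemma ncard_setT (T : finType) : ncard [set: T] = #|T|.
Proof.
rewrite /ncard (_ : fset_set _ = [fset x in T]%fset) ?card_finset //.
apply/fsetP => x; rewrite in_fset_set; last exact: finite_finset.
by rewrite !inE; apply/asboolP.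
Qed.

(** The constant series represent each residue class exactly once. *)
Lemma pseries_residue_size (F : finFieldType) : residue_size (pseries_dvr F) = #|F|.
Proof.
pose h (c : F) := quotient_proj (pseries_max F) (pseries_const c).
have hT : [set: quotient (pseries_max F)] = [set h c | c in setT].
  apply/seteqP; split=> // u _; have [f ->] := quotient_proj_surj u.
  exists (f 0%N) => //; apply/quotient_projP.
  by rewrite /= coef_pseriesB subrr.
rewrite -ncard_setT; apply/fcard_eq.
- by rewrite hT; apply/finite_image/finite_finset.
- exact: finite_finset.
rewrite hT; apply: inj_card_eq => c d _ _ /quotient_projP /= /eqP.
by rewrite coef_pseriesB subr_eq0 => /eqP.
Qed.

(** * Comparison of rational functions *)

Definition pseries_of_poly (F : fieldType) (p : {poly F}) : pseries F := fun n => p`_n.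

Lemma pseries_of_polyM (F : fieldType) (p q : {poly F}) :
  pseries_of_poly (p * q) = pseries_of_poly p * pseries_of_poly q.
Proof. by apply/funext => n; rewrite /pseries_of_poly coefM. Qed.

Lemma pseries_of_poly_inj (F : fieldType) : injective (@pseries_of_poly F).
Proof. by move=> p q pq; apply/polyP => n; have /(congr1 (@^~ n)) := pq. Qed.

(** Substitutes q for X and keeps T. *)
Definition ratfun_specialize (q : nat) : {poly {poly rat}} -> {poly rat} :=
  map_poly (horner_eval q%:R).

HB.instance Definition _ (q : nat) :=
  GRing.RMorphism.copy (ratfun_specialize q) (map_poly (horner_eval q%:R)).

(** The representatives a_i / b_i are arbitrary and b_i may vanish at X = q; cross-multiplying makes
    the conclusion meaningful anyway, so one choice serves for all q. *)
Lemma specializes_to_unique (W1 W2 : ratfun) q Z (a1 b1 a2 b2 : {poly {poly rat}}) :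
    specializes_to W1 q Z -> specializes_to W2 q Z ->
    b1 != 0 -> b2 != 0 ->
    W1 = tofrac a1 / tofrac b1 -> W2 = tofrac a2 / tofrac b2 ->
  ratfun_specialize q (a1 * b2) = ratfun_specialize q (a2 * b1).
Proof.
have cross (W : ratfun) (a b c d : {poly {poly rat}}) :
    W = tofrac a / tofrac b -> W = tofrac c / tofrac d ->
    b != 0 -> d != 0 -> a * d = c * b.
  move=> -> /eqP eqW b0 d0; apply/eqP.
  by rewrite -tofrac_eq !tofracM -eqr_div ?tofrac_eq0.
move=> [c1 [d1 [W1cd d1q0 cd1]]] [c2 [d2 [W2cd d2q0 cd2]]] b10 b20 W1ab W2ab.
have nz d : map_poly (horner_eval q%:R) d != 0 :> {poly rat} -> d != 0.
  by apply: contraNneq => ->; rewrite raddf0.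
have /(congr1 (ratfun_specialize q)) E1 := cross _ _ _ _ _ W1ab W1cd b10 (nz _ d1q0).
have /(congr1 (ratfun_specialize q)) E2 := cross _ _ _ _ _ W2ab W2cd b20 (nz _ d2q0).
have sE c d : (forall k, \sum_(i < k.+1) (map_poly (horner_eval q%:R) d)`_i * Z (k - i)%N =
      (map_poly (horner_eval q%:R) c)`_k) ->
    pseries_of_poly (ratfun_specialize q d) * (Z : pseries rat) =
    pseries_of_poly (ratfun_specialize q c).
  by move=> cdZ; apply/funext => k; rewrite coef_pseriesM cdZ.
(* In Q[[T]], both sides equal d1 d2 Z at X = q. *)
have E12 : ratfun_specialize q c1 * ratfun_specialize q d2 =
           ratfun_specialize q c2 * ratfun_specialize q d1.
  apply: pseries_of_poly_inj.
  by rewrite !pseries_of_polyM -(sE _ _ cd1) -(sE _ _ cd2); ring.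
move: E1 E2; rewrite !rmorphM /= => E1 E2.
have d0 : ratfun_specialize q d1 * ratfun_specialize q d2 != 0 by rewrite mulf_neq0.
apply: (mulIf d0); move: E1 E2 E12.
move: (ratfun_specialize q a1) (ratfun_specialize q b1) (ratfun_specialize q c1)
  (ratfun_specialize q d1) (ratfun_specialize q a2) (ratfun_specialize q b2)
  (ratfun_specialize q c2) (ratfun_specialize q d2) => u1 v1 x1 y1 u2 v2 x2 y2 E1 E2 E12.
have -> : u1 * v2 * (y1 * y2) = u1 * y1 * v2 * y2 by ring.
rewrite E1; have -> : x1 * v1 * v2 * y2 = x1 * y2 * v1 * v2 by ring.
rewrite E12; have -> : u2 * v1 * (y1 * y2) = u2 * y2 * v1 * y1 by ring.
by rewrite E2; ring.
Qed.

Lemma exists_odd_primes N : exists s : seq nat,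
  [/\ uniq s, size s = N & forall p, p \in s -> prime p /\ odd p].
Proof.
elim: N => [|N [s [us sN sP]]]; first by exists [::].
(* Exceeding 2 makes the new prime odd; exceeding the maximum of [s] makes it new. *)
have [p p_gt p_pr] := prime_above (maxn 2 (\max_(q <- s) q)).
exists (p :: s); split=> /=; last 2 first.
- by rewrite sN.
- move=> q /[!inE] /orP[/eqP -> |/sP //]; split=> //.
  have [p2|//] := even_prime p_pr.
  by rewrite p2 gtn_max in p_gt.
rewrite us andbT; apply: contraTN p_gt => ps; rewrite -leqNgt leq_max.
by apply/orP; right; apply: (bigmaxn_sup_seq p).
Qed.

Lemma poly_odd_primes_eq0 (p : {poly rat}) :
  (forall q, prime q -> odd q -> p.[q%:R] = 0) -> p = 0.
Proof.
move=> p0; apply/eqP; apply: contraT => nzp.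
have [s [us sN sP]] := exists_odd_primes (size p).
have /max_poly_roots -/(_ (map (fun q : nat => q%:R) s)) := nzp.
rewrite size_map sN ltnn; apply.
  by apply/allP => _ /mapP[q /sP[qp qo] ->]; apply/eqP/p0.
by rewrite map_inj_uniq // => x y /eqP; rewrite eqr_nat => /eqP.
Qed.

(** Each T-coefficient of a1 b2 - a2 b1 is a polynomial in X vanishing at all odd primes. *)
Lemma ratfun_eq_odd_primes (W1 W2 : ratfun) :
    (forall q, prime q -> odd q -> exists Z, specializes_to W1 q Z /\ specializes_to W2 q Z) ->
  W1 = W2.
Proof.
(* The prime 3 supplies fixed representatives with nonzero denominators. *)
move=> W12; have [Z [W1Z W2Z]] := W12 3 isT isT.
case: W1Z W2Z => [a1 [b1 [W1E b1q _]]] [a2 [b2 [W2E b2q _]]].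
have nz d : map_poly (horner_eval 3%:R) d != 0 :> {poly rat} -> d != 0.
  by apply: contraNneq => ->; rewrite raddf0.
have [b10 b20] := (nz _ b1q, nz _ b2q).
suff E : a1 * b2 = a2 * b1.
  by apply/eqP; rewrite W1E W2E eqr_div ?tofrac_eq0 // -!tofracM E.
apply/eqP; rewrite -subr_eq0; apply/eqP/polyP => i; rewrite coef0.
apply: poly_odd_primes_eq0 => q q_pr q_odd.
have [Z' [W1Z W2Z]] := W12 q q_pr q_odd.
have := specializes_to_unique W1Z W2Z b10 b20 W1E W2E.
move=> /eqP; rewrite -subr_eq0 -rmorphB /= => /eqP /polyP/(_ i).
by rewrite coef0 coef_map.
Qed.

(** * Comparison over the rings F_q[[t]] *)

Theorem theoremB (G : graph) (Wplus Wminus W : ratfun) :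
  reflexive_graph G ->
  is_W_plus G Wplus -> is_W_minus G Wminus -> is_W (Adj G) W ->
  Wplus = Wminus /\ Wminus = W.
Proof.
move=> G_refl plusP minusP WP.
(* The field ['F_q] is defined for every q, but [sizeE] needs q prime. *)
pose O q := pseries_dvr 'F_q.
have askE s q : ask (signed_adjmx s G (O q)) = ask (incidence_mx (Adj G) (O q)).
  apply/funext => k.
  by apply: ask_signed_adjmx => //; [exact: pseries_residue_finite|exact: pseries_dvd_total].
have sizeE q : prime q -> residue_size (O q) = q.
  by move=> q_pr; rewrite pseries_residue_size card_Fp.
have specP q : prime q -> odd q ->
    [/\ specializes_to Wplus q (ask (incidence_mx (Adj G) (O q))),
        specializes_to Wminus q (ask (incidence_mx (Adj G) (O q))) &
        specializes_to W q (ask (incidence_mx (Adj G) (O q)))].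
  move=> q_pr q_odd; have := (plusP (O q), minusP (O q), WP (O q)).
  rewrite (sizeE q q_pr) => -[[/(_ q_odd) Wp /(_ isT) Wm] /(_ isT) Wq].
  rewrite /adjmx_plus (askE false) in Wp.
  rewrite /adjmx_minus (askE true) in Wm.
  split; [exact: Wp|exact: Wm|exact: Wq].
by split; apply: ratfun_eq_odd_primes => q q_pr q_odd; have [? ? ?] := specP q q_pr q_odd;
  exists (ask (incidence_mx (Adj G) (O q))).
Qed.
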